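(* Let $k$ be a positive integer. For every $n \geq \binom{k}{2}+1$, we have $\mathrm{r}_n(12\cdots k)=0$; that is, for every permutation $\pi \in \mathcal{S}_n$ with $n\ge \binom{k}{2}+1$, the word $\pi\pi^r$ contains the pattern $12\cdots k$.
   Context: $\mathcal{S}_n$ is the set of permutations of $[n]=\{1,\dots,n\}$, written in one-line notation $\pi=\pi_1\cdots\pi_n$, and $\pi^r=\pi_n\cdots\pi_1$ is its reversal. A word $w=w_1\cdots w_m$ contains a pattern $\rho\in\mathcal{S}_k$ if there are indices $1\le i_1<\cdots<i_k\le m$ with $w_{i_a}\le w_{i_b}$ if and only if $\rho_a\le\rho_b$; otherwise $w$ avoids $\rho$. The set of reverse double lists on $n$ letters is $\mathcal{R}_n=\{\pi\pi^r : \pi\in\mathcal{S}_n\}$ (concatenation of $\pi$ with its reversal), $\mathcal{R}_n(\rho)$ is the set of members of $\mathcal{R}_n$ avoiding $\rho$, and $\mathrm{r}_n(\rho)=|\mathcal{R}_n(\rho)|$. The pattern $12\cdots k$ is the identity permutation of length $k$. *)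

(* Defs.v *)
From mathcomp Require Import all_boot all_fingroup.
Set Implicit Arguments.
Unset Strict Implicit.
Unset Printing Implicit Defensive.

(** Positions and letters are numbered from 0: the alphabet [n] = {1, ..., n}
    is represented by 'I_n.  Only the relative order of letters matters. *)

Definition one_line (n : nat) (pi : 'S_n) : n.-tuple 'I_n :=
  [tuple pi i | i < n].

Definition reverse_double (n : nat) (pi : 'S_n) : (n + n).-tuple 'I_n :=
  [tuple of one_line pi ++ rev (one_line pi)].

Definition contains (n m k : nat) (w : m.-tuple 'I_n) (rho : 'S_k) : bool :=
  [exists i : {ffun 'I_k -> 'I_m},
    [forall a : 'I_k, forall b : 'I_k, (a < b) ==> (i a < i b)] &&
    [forall a : 'I_k, forall b : 'I_k,
       (tnth w (i a) <= tnth w (i b)) == (rho a <= rho b)]].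

Definition avoids (n m k : nat) (w : m.-tuple 'I_n) (rho : 'S_k) : bool :=
  ~~ contains w rho.

Definition reverse_double_lists (n : nat) : {set (n + n).-tuple 'I_n} :=
  [set reverse_double pi | pi : 'S_n].

Definition avoiding_lists (n k : nat) (rho : 'S_k) :
    {set (n + n).-tuple 'I_n} :=
  [set w in reverse_double_lists n | avoids w rho].

Definition r (n k : nat) (rho : 'S_k) : nat := #|avoiding_lists n rho|.

Definition increasing_pattern (k : nat) : 'S_k := 1%g.

(* Main.v *)
Require Import Defs.
From mathcomp Require Import all_boot all_fingroup zify.

Set Implicit Arguments.
Unset Strict Implicit.

(** For a position [i] of [pi], let [a i] and [d i] be the maximal lengths of an
    increasing, resp. decreasing, subsequence of [pi] ending at [i].  As in the
    Erdős–Szekeres argument the pairs [(a i, d i)] are distinct.  Reading an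
    increasing subsequence in [pi] up to [i], and then a decreasing one backwards
    from [i] in the reversed copy of [pi] gives an increasing subsequence of
    length [a i + d i - 1] in the reverse double list.  If these lengths were all
    less than [k], the pairs [(a i - 1, a i + d i - 1)] would be distinct pairs
    [x < y < k], of which there are only ['C(k, 2)]. *)

Lemma pairwise_rev (T : Type) (e : rel T) (s : seq T) :
  pairwise e (rev s) = pairwise (fun x y => e y x) s.
Proof.
elim: s => //= x s IHs.
by rewrite rev_cons pairwise_rcons all_rev IHs.
Qed.

(** The first [k] entries of [q] serve as the embedding. Letters that strictly increase also yield
    the equivalence required by [contains], since the order on the indices is total. *)
Lemma contains_pairwise (n m k : nat) (w : m.-tuple 'I_n) (q : seq 'I_m) :
    pairwise (fun x y : 'I_m => (x < y) && (tnth w x < tnth w y)) q ->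
    k <= size q -> contains w (increasing_pattern k).
Proof.
move=> q_inc le_k_q; pose f (a : 'I_k) := tnth (in_tuple q) (widen_ord le_k_q a).
have f_inc (a b : 'I_k) : a < b -> (f a < f b) && (tnth w (f a) < tnth w (f b)).
  move=> lt_ab; have x0 := f a.
  rewrite /f !(tnth_nth x0) /=.
  by apply: (pairwiseP x0 q_inc) => //; apply: leq_trans (ltn_ord _) le_k_q.
apply/existsP; exists (finfun f); apply/andP; split.
  apply/forallP => a; apply/forallP => b; apply/implyP => /f_inc /andP[lt_f _].
  by rewrite !ffunE.
apply/forallP => a; apply/forallP => b; rewrite !ffunE /increasing_pattern !perm1.
apply/eqP; case: (ltngtP a b) => [/f_inc|/f_inc|/val_inj ->]; last exact: leqnn.
  by case/andP=> _ /ltnW.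
by case/andP=> _; rewrite ltnNge => /negbTE.
Qed.

Lemma tnth_reverse_double_l (n : nat) (pi : 'S_n) (i : 'I_n) :
  tnth (reverse_double pi) (lshift n i) = pi i.
Proof.
rewrite (tnth_nth i) /= nth_cat size_map size_enum_ord ltn_ord.
by rewrite (nth_map i) ?size_enum_ord // nth_ord_enum.
Qed.

Lemma tnth_reverse_double_r (n : nat) (pi : 'S_n) (i : 'I_n) :
  tnth (reverse_double pi) (rshift n (rev_ord i)) = pi i.
Proof.
rewrite (tnth_nth i) /= nth_cat size_map size_enum_ord ltnNge leq_addr /= addKn.
have lt_in := ltn_ord i.
rewrite nth_rev size_map size_enum_ord; last by lia.
have -> : n - (n - i.+1).+1 = i by lia.
by rewrite (nth_map i) ?size_enum_ord // nth_ord_enum.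
Qed.

Section LongestChain.

Variables (n : nat) (e : rel 'I_n).

(** A subsequence is encoded by its set of positions, with [i] the last one. As [e] is only tested
    on [x < y], the same definition serves increasing and decreasing subsequences. *)
Definition chain_to (i : 'I_n) (S : {set 'I_n}) : bool :=
  [&& i \in S, [forall x in S, x <= i] &
      [forall x in S, forall y in S, (x < y) ==> e x y]].

Definition longest_to (i : 'I_n) : nat := \max_(S | chain_to i S) #|S|.

Lemma chain_toP (i : 'I_n) (S : {set 'I_n}) :
  reflect [/\ i \in S, {in S, forall x : 'I_n, x <= i} &
              {in S &, forall x y : 'I_n, x < y -> e x y}]
          (chain_to i S).
Proof.
apply: (iffP and3P) => -[iS Si Se]; split=> //.
- by move=> x xS; apply: (forall_inP Si).
- by move=> x y xS yS; apply/implyP/(forall_inP (forall_inP Se x xS)).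
- exact/forall_inP.
by apply/forall_inP => x xS; apply/forall_inP => y yS; apply/implyP/Se.
Qed.

Lemma longest_to_chain (i : 'I_n) : {S | chain_to i S & longest_to i = #|S|}.
Proof.
(* The singleton makes the family of chains nonempty, so that the maximum is attained. *)
have ch1 : chain_to i [set i].
  apply/chain_toP; split; first exact: set11.
    by move=> x /set1P->.
  by move=> x y /set1P-> /set1P->; rewrite ltnn.
by have [|S] := eq_bigmax_cond (fun S : {set 'I_n} => #|S|) (A := chain_to i);
  [apply/card_gt0P; exists [set i] | exists S].
Qed.

Lemma longest_to_gt0 (i : 'I_n) : 0 < longest_to i.
Proof.
have [S /chain_toP[iS _ _] ->] := longest_to_chain i.
by apply/card_gt0P; exists i.
Qed.

(** A longest chain ending at [i] is extended by [j]; transitivity through [i] relates its earlier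
    elements to [j]. *)
Lemma longest_to_lt (i j : 'I_n) :
  transitive e -> i < j -> e i j -> longest_to i < longest_to j.
Proof.
move=> e_tr lt_ij e_ij; have [S /chain_toP[iS Si Se] ->] := longest_to_chain i.
have S_lt x : x \in S -> x < j by move/Si => /leq_ltn_trans; apply.
have jS : j \notin S by apply/negP => /S_lt; rewrite ltnn.
have <- : #|j |: S| = #|S|.+1 by rewrite cardsU1 jS.
apply: leq_bigmax_cond; apply/chain_toP; split; first exact: setU11.
  by move=> x /setU1P[-> //|/S_lt/ltnW].
move=> x y /setU1P[->|xS] /setU1P[->|yS]; rewrite ?ltnn //.
- by move/S_lt: yS; lia.
- move=> _; have := Si x xS; rewrite leq_eqVlt => /predU1P[/val_inj -> //|lt_xi].
  by apply: e_tr e_ij; apply: Se.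
exact: Se.
Qed.

Lemma pairwise_enum_chain (i : 'I_n) (S : {set 'I_n}) :
  chain_to i S -> pairwise (fun x y : 'I_n => (x < y) && e x y) (enum S).
Proof.
case/chain_toP=> _ _ Se.
have lt_enum : pairwise (fun x y : 'I_n => x < y) (enum S).
  rewrite /enum_mem; apply: subseq_pairwise (filter_subseq _ _) _.
  rewrite -enumT -(pairwise_map val ltn) val_enum_ord.
  by rewrite -(sorted_pairwise ltn_trans) iota_ltn_sorted.
apply: (sub_in_pairwise (P := mem S)) lt_enum; last first.
  by apply/allP => x; rewrite mem_enum.
by move=> x y xS yS /= lt_xy; rewrite lt_xy Se.
Qed.

End LongestChain.

Section ReverseDouble.

Variables (n : nat) (pi : 'S_n).

Let asc : rel 'I_n := fun x y => pi x < pi y.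
Let desc : rel 'I_n := fun x y => pi y < pi x.

Let asc_trans : transitive asc.
Proof. by move=> y x z; apply: ltn_trans. Qed.

Let desc_trans : transitive desc.
Proof. by move=> y x z xy yz; apply: ltn_trans yz xy. Qed.

(** Of two positions, the later one has the strictly larger [asc] or [desc] length, according to how
    their letters compare. *)
Lemma longest_to_inj (i j : 'I_n) :
  longest_to asc i = longest_to asc j -> longest_to desc i = longest_to desc j ->
  i = j.
Proof.
have neq (x y : 'I_n) : x < y ->
    longest_to asc x < longest_to asc y \/ longest_to desc x < longest_to desc y.
  move=> lt_xy; case: (ltngtP (pi x) (pi y)) => [lt_p|gt_p|/val_inj/perm_inj eq_xy].
  - by left; apply: longest_to_lt.
  - by right; apply: longest_to_lt.
  by rewrite eq_xy ltnn in lt_xy.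
move=> eq_a eq_d; case: (ltngtP i j) => [/neq|/neq|/val_inj //];
  by rewrite eq_a eq_d !ltnn; case.
Qed.

Lemma contains_longest (i : 'I_n) (k : nat) :
  k < longest_to asc i + longest_to desc i ->
  contains (reverse_double pi) (increasing_pattern k).
Proof.
have [A chA ->] := longest_to_chain asc i.
have [D chD ->] := longest_to_chain desc i => lt_k.
have /chain_toP[iA Ai Ae] := chA; have /chain_toP[iD Di De] := chD.
pose right_pos x : 'I_(n + n) := rshift n (rev_ord x).
(* The position [i] is dropped from [D] because its letter is already read in the first copy; hence
   the length [#|A| + #|D| - 1]. *)
pose q := map (lshift n) (enum A) ++ map right_pos (rev (rem i (enum D))).
apply: (@contains_pairwise _ _ _ _ q); last first.
  rewrite size_cat !size_map size_rev size_rem ?mem_enum // -!cardE.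
  by rewrite -ltnS -addnS prednK //; apply/card_gt0P; exists i.
rewrite pairwise_cat !pairwise_map; apply/and3P; split.
(* At the junction, letters from [A] are at most [pi i], and those from the rest of [D] exceed
   it. *)
- apply/allrelP => _ _ /mapP[x xA ->] /mapP[y yD ->].
  rewrite tnth_reverse_double_l tnth_reverse_double_r.
  rewrite mem_enum in xA; rewrite mem_rev (mem_rem_uniq i (enum_uniq D)) in yD.
  case/andP: yD => neq_yi; rewrite mem_enum => yD.
  have lt_yi : y < i by rewrite ltn_neqAle Di // andbT; apply: contra neq_yi.
  have lt_p : pi i < pi y := De _ _ yD iD lt_yi.
  have le_p : pi x <= pi i.
    have := Ai x xA; rewrite leq_eqVlt => /predU1P[/val_inj -> //|lt_xi].
    exact/ltnW/Ae.
  by rewrite (leq_ltn_trans le_p lt_p) andbT /=; have := ltn_ord x; lia.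
- apply: sub_pairwise (pairwise_enum_chain chA) => x y.
  by rewrite /= !tnth_reverse_double_l.
rewrite pairwise_rev; apply: subseq_pairwise (rem_subseq _ _) _.
apply: sub_pairwise (pairwise_enum_chain chD) => x y.
rewrite /= !tnth_reverse_double_r => /andP[lt_xy desc_xy].
apply/andP; split=> //; have := ltn_ord y; lia.
Qed.

Lemma ex_longest_sum (k : nat) :
  0 < k -> 'C(k, 2) < n -> exists i, k < longest_to asc i + longest_to desc i.
Proof.
case: k => // k _ lt_kn; apply/existsP; apply: contraLR lt_kn.
rewrite negb_exists -leqNgt => /forallP small.
pose a i := longest_to asc i; pose d i := longest_to desc i.
have a_gt0 i : 0 < a i by apply: longest_to_gt0.
have d_gt0 i : 0 < d i by apply: longest_to_gt0.
have sum_le i : a i + d i <= k.+1 by rewrite leqNgt small.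
(* Here [k.+1] is the original [k]. By [f_lt] both values are in range, so [inord] never falls back
   on its default. *)
pose f i : 2.-tuple 'I_k.+1 := [tuple inord (a i).-1; inord (a i + d i).-1].
have f_lt i : (a i).-1 < (a i + d i).-1 < k.+1.
  by move: (a_gt0 i) (d_gt0 i) (sum_le i); lia.
have valf i : map val (f i) = [:: (a i).-1; (a i + d i).-1].
  by have /andP[lt_a lt_k] := f_lt i; rewrite /= !inordK // (ltn_trans lt_a).
have f_inj : injective f.
  move=> i j eq_f; have := valf i; rewrite eq_f valf => -[eq_a eq_ad].
  move: (a_gt0 i) (a_gt0 j) (d_gt0 i) (d_gt0 j) => ai aj di dj.
  have [eq_ai eq_di] : a i = a j /\ d i = d j by lia.
  exact: longest_to_inj.
(* The binomial coefficient is read as the number of strictly increasing pairs in ['I_k.+1], among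
   which all values of [f] lie. *)
rewrite -(card_ord n) -(card_imset _ f_inj) -card_ltn_sorted_tuples.
apply/subset_leq_card/subsetP => _ /imsetP[i _ ->].
by rewrite inE valf /= andbT; case/andP: (f_lt i).
Qed.

End ReverseDouble.

Unset Implicit Arguments.
Set Strict Implicit.

Theorem theorem1 (k : nat) (hk : 0 < k) (n : nat) (hn : 'C(k, 2) + 1 <= n) :
  r n (increasing_pattern k) = 0 /\
  (forall pi : 'S_n, contains (reverse_double pi) (increasing_pattern k)).
Proof.
have all_contain (pi : 'S_n) : contains (reverse_double pi) (increasing_pattern k).
  rewrite addn1 in hn; have [i lt_k] := ex_longest_sum pi hk hn.
  exact: contains_longest lt_k.
split=> //; apply/eqP; rewrite cards_eq0; apply/eqP/setP => w; rewrite !inE.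
by apply/andP => -[/imsetP[pi _ ->]]; rewrite /avoids all_contain.
Qed.
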